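(* Let $d$ be a positive integer. A $d$-dimensional array of real-valued random variables $\{X_{\mathbf n},\mathbf n\in\mathbb{Z}_+^d\}$ is uniformly integrable in the Cesàro sense if and only if both of the following hold: (i) $\displaystyle\sup_{\mathbf n\succ\mathbf 1}\frac{1}{|\mathbf n|}\sum_{\mathbf i\prec\mathbf n}\mathbb{E}(|X_{\mathbf i}|)<\infty$; (ii) for each $\varepsilon>0$ there exists $\delta>0$ such that whenever $\{A_{\mathbf n},\mathbf n\in\mathbb{Z}_+^d\}$ is a $d$-dimensional array of events satisfying $$\sup_{\mathbf n\succ\mathbf 1}\frac{1}{|\mathbf n|}\sum_{\mathbf i\prec\mathbf n}\mathbb{P}(A_{\mathbf i})<\delta,$$ we have $$\sup_{\mathbf n\succ\mathbf 1}\frac{1}{|\mathbf n|}\sum_{\mathbf i\prec\mathbf n}\mathbb{E}\big(|X_{\mathbf i}|\,\mathbf 1(A_{\mathbf i})\big)<\varepsilon .$$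
   Context: All random variables and events are on a common probability space $(\Omega,\mathcal{F},\mathbb{P})$. $\mathbb{Z}_+^d$ is the set of $d$-tuples of positive integers. For $\mathbf m=(m_1,\dots,m_d)$ and $\mathbf n=(n_1,\dots,n_d)$ in $\mathbb{Z}_+^d$, $\mathbf m\prec\mathbf n$ (equivalently $\mathbf n\succ\mathbf m$) means $m_i\le n_i$ for all $1\le i\le d$; $|\mathbf n|=\prod_{i=1}^d n_i$; $\mathbf 1=(1,\dots,1)$. Sums over $\mathbf i\prec\mathbf n$ run over $\mathbf i\in\mathbb{Z}_+^d$. $\mathbf 1(A)$ denotes the indicator function of the event $A$. A $d$-dimensional array of real-valued random variables $\{X_{\mathbf n},\mathbf n\in\mathbb{Z}_+^d\}$ is uniformly integrable in the Cesàro sense if $$\lim_{a\to\infty}\ \sup_{\mathbf n\succ\mathbf 1}\frac{1}{|\mathbf n|}\sum_{\mathbf i\prec\mathbf n}\mathbb{E}\big(|X_{\mathbf i}|\,\mathbf 1(|X_{\mathbf i}|>a)\big)=0 .$$ *)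

(* Defs.v *)
From HB Require Import structures.
From mathcomp Require Import all_boot all_order all_algebra.
From mathcomp Require Import all_classical all_reals all_analysis.
Import Order.TTheory GRing.Theory Num.Theory numFieldNormedType.Exports.

Set Implicit Arguments.
Unset Strict Implicit.
Unset Printing Implicit Defensive.

Local Open Scope classical_set_scope.
Local Open Scope ring_scope.
Local Open Scope ereal_scope.

(* Z_+^d with positive (not merely nonnegative) integer coordinates, so
   n >= 1 coordinatewise holds for every [n : multi d] and the suprema below
   range over the whole type. *)
Definition multi (d : nat) := {ffun 'I_d -> {n : nat | (0 < n)%N}}.

Definition multi_le (d : nat) (m n : multi d) : bool :=
  [forall k, (val (m k) <= val (n k))%N].

Definition multi_vol (d : nat) (n : multi d) : nat :=
  (\prod_(k < d) val (n k))%N.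

(* [\sum_(i \in A)] is the finitely supported sum, with value 0 on an infinite
   support; here the set of indices is finite. *)
Definition cesaro_sup (R : realType) (d : nat) (f : multi d -> \bar R) : \bar R :=
  ereal_sup [set ((multi_vol n)%:R^-1)%:E *
                   \sum_(i \in [set i | multi_le i n]) f i | n in [set: multi d]].

Definition cesaro_ui (disp : measure_display) (T : measurableType disp)
    (R : realType) (P : probability T R) (d : nat)
    (X : multi d -> {RV P >-> R}) : Prop :=
  cesaro_sup (fun i =>
      'E_P[fun w => `|X i w| * \1_[set w' | (a < `|X i w'|)%R] w]%R)
    @[a --> +oo%R] --> 0.

(* Main.v *)
(* For a >= 0 and an event A, |X| 1_A <= a 1_A + |X| 1(|X| > a). Averaging over
   i <= n and taking suprema gives (ii) from uniform integrability, and (i) by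
   taking A to be the whole space. Conversely, apply (ii) to the events
   |X_i| > a: by Markov's inequality and (i) the supremum of the averages of
   their probabilities is O(1/a). *)
Require Import Defs.
From HB Require Import structures.
From mathcomp Require Import all_boot all_order all_algebra.
From mathcomp Require Import all_classical all_reals all_analysis.
From mathcomp Require Import measurable_realfun.
Import Order.TTheory GRing.Theory Num.Theory numFieldNormedType.Exports.

Local Open Scope classical_set_scope.
Local Open Scope ring_scope.
Local Open Scope ereal_scope.

Lemma multi_vol_gt0 (d : nat) (n : multi d) : (0 < multi_vol n)%N.
Proof. by rewrite prodn_gt0 // => k; exact: (valP (n k)). Qed.

(** The indices below [n] form a box: lowering every coordinate by one identifies them with the
    dependent functions sending [k] into ['I_(val (n k))], whose number is the product of the side
    lengths. [box] is the inverse shift. *)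
Lemma multi_le_enum (d : nat) (n : multi d) :
  exists r : seq (multi d),
    [/\ uniq r, size r = multi_vol n & r =i [pred i | multi_le i n]].
Proof.
pose D := {dffun forall k : 'I_d, 'I_(val (n k))}.
pose box (h : D) : multi d :=
  [ffun k => exist (fun m => (0 < m)%N) (val (h k)).+1 (ltn0Sn _)].
exists [seq box h | h <- enum D]; split.
- rewrite map_inj_uniq ?enum_uniq // => h1 h2 /ffunP h12.
  apply/ffunP => k; apply/val_inj.
  by have /(congr1 val) := h12 k; rewrite !ffunE => -[].
- rewrite size_map -cardE card_dep_ffun foldrE big_image.
  by apply: eq_bigr => k _; rewrite card_ord.
- move=> i; rewrite inE; apply/mapP/forallP => [[h _ ->] k|le_in].
    by rewrite ffunE /=; exact: ltn_ord.
  have lt_in k : ((val (i k)).-1 < val (n k))%N.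
    by rewrite prednK ?le_in //; exact: (valP (i k)).
  exists [ffun k => Ordinal (lt_in k)]; first by rewrite mem_enum.
  apply/ffunP => k; apply/val_inj; rewrite !ffunE /=.
  by rewrite prednK //; exact: (valP (i k)).
Qed.

(** The list is chosen before [f], so a single enumeration serves several sums over the same box. *)
Lemma multi_le_fsbig (R : realType) (d : nat) (n : multi d) :
  exists2 r : seq (multi d), size r = multi_vol n &
    forall f : multi d -> \bar R,
      \sum_(i \in [set i | multi_le i n]) f i = \sum_(i <- r) f i.
Proof.
have [r [ur sr memr]] := multi_le_enum d n; exists r => // f.
have -> : [set i : multi d | multi_le i n] = [set` r].
  by apply/seteqP; split=> i /=; rewrite memr inE.
by apply/esym; exact: fsbig_seq.
Qed.

Lemma cesaro_sup_cst (R : realType) (d : nat) (c : R) :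
  @cesaro_sup R d (fun=> c%:E) = c%:E.
Proof.
rewrite /cesaro_sup -[RHS]ereal_sup1; congr ereal_sup; apply/seteqP.
have mean_cst (n : multi d) : ((multi_vol n)%:R^-1)%:E *
    \sum_(i \in [set i | multi_le i n]) c%:E = c%:E.
  have [r sr ->] := multi_le_fsbig R d n.
  rewrite sumEFin -EFinM big_const_seq count_predT iter_addr_0 sr.
  by rewrite -[(c *+ _)%R]mulr_natl mulKf // pnatr_eq0 -lt0n multi_vol_gt0.
split=> x /=; first by move=> [n _ <-]; rewrite mean_cst.
(* The index with all coordinates 1 witnesses that the family of means is nonempty, so the constant
   is attained. *)
by move=> ->; exists [ffun=> exist _ 1%N isT].
Qed.

(** Transfers a termwise bound to suprema of averages; both directions of the theorem rest on it.
    Nonnegativity of [f] and [g] makes distributivity valid in [\bar R] even when some values are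
    infinite. *)
Lemma le_cesaro_sup_affine (R : realType) (d : nat) (c : R)
    (f g h : multi d -> \bar R) :
  (0 <= c)%R -> (forall i, 0 <= f i) -> (forall i, 0 <= g i) ->
  (forall i, h i <= c%:E * f i + g i) ->
  cesaro_sup h <= c%:E * cesaro_sup f + cesaro_sup g.
Proof.
move=> c0 f0 g0 hfg; apply: ge_ereal_sup => _ [n _ <-].
have fn : ((multi_vol n)%:R^-1)%:E *
    \sum_(i \in [set i | multi_le i n]) f i <= cesaro_sup f.
  by apply: ereal_sup_ubound; exists n.
have gn : ((multi_vol n)%:R^-1)%:E *
    \sum_(i \in [set i | multi_le i n]) g i <= cesaro_sup g.
  by apply: ereal_sup_ubound; exists n.
apply: le_trans (leeD (lee_wpmul2l _ fn) gn); last by rewrite lee_fin.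
have [r _ rE] := multi_le_fsbig R d n; rewrite !rE muleCA -ge0_muleDr.
- apply: lee_wpmul2l; first by rewrite lee_fin invr_ge0.
  rewrite ge0_sume_distrr // -big_split.
  by apply: lee_sum => i _; exact: hfg.
- by rewrite mule_ge0 ?lee_fin // sume_ge0.
- by rewrite sume_ge0.
Qed.

Lemma le_cesaro_sup (R : realType) (d : nat) (f g : multi d -> \bar R) :
  (forall i, 0 <= g i) -> (forall i, f i <= g i) ->
  cesaro_sup f <= cesaro_sup g.
Proof.
(* Take [c = 0]: the first term vanishes because [0 * x = 0] in [\bar R] even for infinite [x], and
   [g] fills its slot. *)
move=> g0 fg.
have := @le_cesaro_sup_affine R d 0 g g f (lexx _) g0 g0.
by rewrite mul0e add0e; apply=> i; rewrite mul0e add0e.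
Qed.

Lemma cesaro_sup_ge0 (R : realType) (d : nat) (f : multi d -> \bar R) :
  (forall i, 0 <= f i) -> 0 <= cesaro_sup f.
Proof.
by move=> f0; rewrite -[leLHS](cesaro_sup_cst R d 0); exact: le_cesaro_sup.
Qed.

Section truncation.
Context {disp : measure_display} {T : measurableType disp} {R : realType}
  {P : probability T R}.
Implicit Types (X : {RV P >-> R}) (A : set T).

Lemma measurable_norm_gt X (a : R) : measurable [set w | (a < `|X w|)%R].
Proof.
have mX : measurable_fun setT (fun w => `|X w|%R).
  exact: measurableT_comp (measurable_funP X).
have := mX measurableT `]a, +oo[%classic (measurable_itv _).
rewrite setTI; congr (measurable _); apply/seteqP.
by split=> w /=; rewrite in_itv /= andbT.
Qed.

Lemma measurable_norm_indic X A : measurable A ->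
  measurable_fun setT (fun w => (`|X w| * \1_A w)%:E).
Proof.
move=> mA; apply/measurable_EFinP/measurable_funM.
  exact: measurableT_comp (measurable_funP X).
exact: measurable_indic.
Qed.

Lemma expectation_norm_indic_ge0 X A : 0 <= 'E_P[fun w => `|X w| * \1_A w]%R.
Proof. by apply: expectation_ge0 => w; rewrite mulr_ge0. Qed.

Lemma expectation_norm_indic_le X (a : R) A : (0 <= a)%R -> measurable A ->
  'E_P[fun w => `|X w| * \1_A w]%R <=
    a%:E * P A + 'E_P[fun w => `|X w| * \1_[set w' | (a < `|X w'|)%R] w]%R.
Proof.
move=> a0 mA; have mX := measurable_norm_gt X a.
have maA : measurable_fun setT (fun w => a%:E * (\1_A w)%:E).
  by apply/measurable_EFinP/measurable_funM => //; exact: measurable_indic.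
(* Writing [P A] as the integral of an indicator turns the right side into a single integral, so a
   pointwise comparison suffices. *)
rewrite unlock -(setIT A) -(integral_indic P measurableT mA) setIT.
rewrite -ge0_integralZl //; last first.
  by apply/measurable_EFinP; exact: measurable_indic.
rewrite -ge0_integralD //.
- apply: ge0_le_integral => //.
  + exact: measurable_norm_indic.
  + by apply: emeasurable_funD => //; exact: measurable_norm_indic.
  + move=> w _; rewrite -EFinM -EFinD lee_fin.
    have [wA|wA] := pselect (A w); last first.
      by rewrite !indicE (memNset wA) !mulr0 add0r mulr_ge0.
    rewrite indicE (mem_set wA) !mulr1 indicE.
    have [Xa|aX] := leP `|X w|%R a; last by rewrite mem_set // mulr1 lerDr.
    by rewrite memNset ?mulr0 ?addr0 //= ltNge Xa.
- by move=> w _; rewrite -EFinM lee_fin mulr_ge0.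
- exact: measurable_norm_indic.
Qed.

Lemma expectation_norm_le X (a : R) : (0 <= a)%R ->
  'E_P[fun w => `|X w|]%R <=
    a%:E + 'E_P[fun w => `|X w| * \1_[set w' | (a < `|X w'|)%R] w]%R.
Proof.
move=> a0; have := @expectation_norm_indic_le X a setT a0 measurableT.
rewrite probability_setT mule1; congr (_ <= _); congr expectation.
by apply/funext => w; rewrite indicT mulr1.
Qed.

(** Markov's inequality, by integrating [a * 1(|X| > a) <= |X|]. *)
Lemma probability_norm_gt_le X (a : R) : (0 < a)%R ->
  P [set w | (a < `|X w|)%R] <= a^-1%:E * 'E_P[fun w => `|X w|]%R.
Proof.
move=> a0; have mA := measurable_norm_gt X a.
rewrite lee_pdivlMl // unlock.
rewrite -(setIT [set w | _]) -(integral_indic P measurableT mA).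
rewrite -ge0_integralZl //; last 2 first.
  by apply/measurable_EFinP; exact: measurable_indic.
  by rewrite lee_fin ltW.
apply: ge0_le_integral => //.
- by move=> w _; rewrite -EFinM lee_fin mulr_ge0 // ltW.
- by apply/measurable_EFinP/measurable_funM => //; exact: measurable_indic.
- by apply/measurable_EFinP; exact: measurableT_comp (measurable_funP X).
- move=> w _; rewrite -EFinM lee_fin indicE.
  have [Xa|aX] := leP `|X w|%R a; last by rewrite mem_set // mulr1 ltW.
  by rewrite memNset ?mulr0 //= ltNge Xa.
Qed.

End truncation.

Theorem theorem3 (disp : measure_display) (T : measurableType disp)
    (R : realType) (P : probability T R) (d : nat) (hd : (0 < d)%N)
    (X : multi d -> {RV P >-> R}) :
  cesaro_ui X <->
  (cesaro_sup (fun i => 'E_P[fun w => `|X i w|%R]) < +oo /\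
   forall eps : R, (0 < eps)%R ->
     exists2 delta : R, (0 < delta)%R &
       forall A : multi d -> set T,
         (forall n, measurable (A n)) ->
         cesaro_sup (fun i => P (A i)) < delta%:E ->
         cesaro_sup (fun i => 'E_P[fun w => `|X i w| * \1_(A i) w]%R)
           < eps%:E).
Proof.
pose tail a := cesaro_sup (fun i =>
  'E_P[fun w => `|X i w| * \1_[set w' | (a < `|X i w'|)%R] w]%R).
have tail0 a : 0 <= tail a.
  by apply: cesaro_sup_ge0 => i; exact: expectation_norm_indic_ge0.
split=> [ui|[meanX uac]].
(* Convergence makes the tail small for all large [a]; intersecting with the positive [a] permits
   dividing by [a] below. *)
- have tail_lt (e : R) : (0 < e)%R -> exists2 a : R, (0 < a)%R & tail a < e%:E.
    move=> e0.
    have near_tail : \forall a \near +oo%R, tail a < e%:E.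
      by apply: (ui [set y | y < e%:E]); exact: open_ereal_lt'.
    have near_gt0 := nbhs_pinfty_gt (num_real (0 : R)).
    by have [a [a0 ta]] := filter_ex (filterI near_gt0 near_tail); exists a.
  split.
    have [a a0 ta] := tail_lt 1%R ltr01.
    apply: (@le_lt_trans _ _ (a%:E * cesaro_sup (fun=> 1%:E) + tail a)).
      apply: le_cesaro_sup_affine => [|//|i|i]; first exact: ltW.
        exact: expectation_norm_indic_ge0.
      by rewrite mule1; apply: expectation_norm_le; exact: ltW.
    by rewrite cesaro_sup_cst mule1 lte_add_pinfty ?ltry // (lt_trans ta) ?ltry.
  move=> eps eps0; have eps2 : (0 < eps / 2)%R by rewrite divr_gt0.
  have [a a0 ta] := tail_lt _ eps2.
  (* With this [delta], the term [a * sup] of the averaged probabilities stays below [eps / 2]; the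
     tail takes the other half. *)
  exists (eps / 2 / a)%R => [|A mA PA]; first by rewrite divr_gt0.
  apply: (@le_lt_trans _ _ (a%:E * cesaro_sup (fun i => P (A i)) + tail a)).
    apply: le_cesaro_sup_affine => [|//|i|i]; first exact: ltW.
      exact: expectation_norm_indic_ge0.
    by apply: expectation_norm_indic_le => //; exact: ltW.
  rewrite [eps]splitr EFinD; apply: lteD => //.
  by rewrite -lte_pdivlMl // -EFinM mulrC.
- pose M := cesaro_sup (fun i => 'E_P[fun w => `|X i w|%R]).
  have M0 : 0 <= M by apply: cesaro_sup_ge0 => i; exact: expectation_ge0.
  have Mfin : M \is a fin_num by rewrite ge0_fin_numE.
  have small_tail (e : R) : (0 < e)%R -> \forall a \near +oo%R, tail a < e%:E.
    move=> e0; have [delta delta0 uacX] := uac e e0.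
    near=> a; have a0 : (0 < a)%R by near: a; exact: nbhs_pinfty_gt.
    apply: uacX => [i|]; first exact: measurable_norm_gt.
    (* Markov's inequality termwise, with zero as the additive part of the affine bound. *)
    apply: (@le_lt_trans _ _ (a^-1%:E * M + cesaro_sup (fun=> 0%:E))).
      apply: le_cesaro_sup_affine => [|i|//|i].
      + by rewrite invr_ge0 ltW.
      + exact: expectation_ge0.
      + by rewrite adde0; exact: probability_norm_gt_le.
    (* As [M] is finite, what remains is [M / delta < a], true for all large [a]. *)
    rewrite cesaro_sup_cst adde0 lte_pdivrMl // -(fineK Mfin) -EFinM lte_fin.
    by rewrite -ltr_pdivrMr //; near: a; apply: nbhs_pinfty_gt; exact: num_real.
  (* Convergence to a finite limit in [\bar R] means that the tails are eventually finite, here by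
     [small_tail] at 1, and that their real values converge. *)
  rewrite /cesaro_ui; apply/fine_cvgP; split.
    near=> a; rewrite ge0_fin_numE; last exact: tail0.
    apply: (@lt_trans _ _ 1%:E); last exact: ltry.
    by near: a; exact: small_tail.
  apply/cvgrPdist_lt => e e0; near=> a.
  have ta : tail a < e%:E by near: a; exact: small_tail.
  rewrite sub0r normrN ger0_norm; last exact: fine_ge0 (tail0 a).
  rewrite -lte_fin fineK //.
  by rewrite ge0_fin_numE; [exact: lt_trans ta (ltry _) | exact: tail0].
Unshelve. all: by end_near.
Qed.
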